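(* Let $\phi:\mathbb{R}\to\mathbb{R}$ be positively homogeneous (i.e. $\phi(\alpha x)=\alpha\phi(x)$ for all $\alpha\ge0$ and $x\in\mathbb{R}$) and nonexpansive (i.e. $1$-Lipschitz). Consider an IHGNN model with activation $\phi$ on an admissible hypergraph, with weights $\mathbf{W},\boldsymbol{\Theta}_1,\boldsymbol{\Theta}_2,\mathbf{b}$, such that $\lambda_{\max}(|\mathbf{W}|)<1$. Then there exists an equivalent IHGNN model (on the same hypergraph, with the same activation) with weights $\widetilde{\mathbf{W}},\widetilde{\boldsymbol{\Theta}}_1,\widetilde{\boldsymbol{\Theta}}_2,\widetilde{\mathbf{b}}$ of the same respective sizes such that $\|\widetilde{\mathbf{W}}\|_\infty<1$, and both models produce identical outputs for every input $\mathbf{X}\in\mathbb{R}^{n\times d}$.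
   Context: A weighted hypergraph $G=(V,E,\mathbf{w})$ has nodes $V=\{v_1,\dots,v_n\}$, hyperedges $E=\{e_1,\dots,e_m\}$ (each a nonempty subset of $V$), and a hyperedge-weight vector $\mathbf{w}=(w_1,\dots,w_m)^\top\in\mathbb{R}^m$. Its incidence matrix $\mathbf{H}\in\{0,1\}^{n\times m}$ has $\mathbf{H}_{i,j}=1$ if $v_i\in e_j$ and $0$ otherwise. Let $\mathbf{E}=\mathrm{Diag}(\mathbf{w})\in\mathbb{R}^{m\times m}$; let $\mathbf{D}\in\mathbb{R}^{n\times n}$ be the diagonal node degree matrix with $\mathbf{D}_{i,i}=\sum_{j=1}^m\mathbf{H}_{i,j}w_j$; let $\mathbf{B}\in\mathbb{R}^{m\times m}$ be the diagonal hyperedge degree matrix with $\mathbf{B}_{j,j}=\sum_{i=1}^n\mathbf{H}_{i,j}$. The hypergraph is admissible if every hyperedge weight is nonnegative and every node has positive degree. The normalized hypergraph Laplacian matrix is $\mathbf{M}:=\mathbf{D}^{-1/2}\mathbf{H}\mathbf{E}\mathbf{B}^{-1}\mathbf{H}^\top\mathbf{D}^{-1/2}$. An IHGNN on the hypergraph, with activation $\phi:\mathbb{R}\to\mathbb{R}$ (applied entrywise) and weights $\mathbf{W}\in\mathbb{R}^{d_h\times d_h}$, $\boldsymbol{\Theta}_1\in\mathbb{R}^{d\times d_h}$, $\boldsymbol{\Theta}_2\in\mathbb{R}^{d_h\times d'}$, $\mathbf{b}\in\mathbb{R}^{d_h}$, is the map sending $\mathbf{X}\in\mathbb{R}^{n\times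 d}$ to $\widehat{\mathbf{Y}}=\mathbf{Z}\boldsymbol{\Theta}_2\in\mathbb{R}^{n\times d'}$, where $\mathbf{Z}\in\mathbb{R}^{n\times d_h}$ is the solution of $\mathbf{Z}=\phi(\mathbf{M}\mathbf{Z}\mathbf{W}+\mathbf{X}\boldsymbol{\Theta}_1+\mathbf{1}_n\mathbf{b}^\top)$; the map is well defined when this equation has a unique solution. For a matrix $\mathbf{W}$, $|\mathbf{W}|$ is the entrywise absolute value, $\lambda_{\max}$ denotes the largest eigenvalue (for the nonnegative matrix $|\mathbf{W}|$, the Perron–Frobenius eigenvalue), and $\|\mathbf{A}\|_\infty:=\max_i\sum_j|\mathbf{A}_{i,j}|$ is the maximum-row-sum norm. *)

(* Defs.v *)
From mathcomp Require Export all_boot all_order all_algebra.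
From mathcomp Require Export boolp classical_sets reals.
From mathcomp Require Export topology normedtype.

Set Implicit Arguments.
Unset Strict Implicit.
Unset Printing Implicit Defensive.

Export Order.TTheory GRing.Theory Num.Theory numFieldNormedType.Exports.

#[global] Open Scope classical_set_scope.
#[global] Open Scope ring_scope.

(* The hyperedges form a family indexed by 'I_m; a hyperedge may be repeated. *)
Record hypergraph (R : realType) (n m : nat) := Hypergraph {
  hedge : 'I_m -> {set 'I_n};
  hedge_neq0 : forall j, hedge j != finset.set0;
  hweight : 'rV[R]_m
}.

Section HypergraphMatrices.
Context (R : realType) (n m : nat) (G : hypergraph R n m).

Definition incidence_mx : 'M[R]_(n, m) := \matrix_(i, j) (i \in hedge G j)%:R.

Definition weight_mx : 'M[R]_m := diag_mx (hweight G).

Definition node_degree (i : 'I_n) : R :=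
  \sum_j incidence_mx i j * hweight G 0 j.

Definition hedge_degree (j : 'I_m) : R := \sum_i incidence_mx i j.

Definition node_degree_mx : 'M[R]_n := diag_mx (\row_i node_degree i).

Definition hedge_degree_mx : 'M[R]_m := diag_mx (\row_j hedge_degree j).

Definition admissible : Prop :=
  (forall j, 0 <= hweight G 0 j) /\ (forall i, 0 < node_degree_mx i i).

Definition node_degree_invsqrt_mx : 'M[R]_n :=
  diag_mx (\row_i (Num.sqrt (node_degree_mx i i))^-1).

Definition laplacian_mx : 'M[R]_n :=
  node_degree_invsqrt_mx *m incidence_mx *m weight_mx *m invmx hedge_degree_mx
    *m incidence_mx^T *m node_degree_invsqrt_mx.

End HypergraphMatrices.

Definition pos_homogeneous (R : realType) (phi : R -> R) : Prop :=
  forall a x, 0 <= a -> phi (a * x) = a * phi x.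

Definition nonexpansive (R : realType) (phi : R -> R) : Prop :=
  1.-lipschitz phi.

Definition abs_mx (R : realType) (p q : nat) (A : 'M[R]_(p, q)) :
    'M[R]_(p, q) :=
  map_mx (fun x => `|x|) A.

(* Maximum row sum; MathComp-Analysis' `|A| is the largest absolute entry. *)
Definition norm_inf (R : realType) (p q : nat) (A : 'M[R]_(p, q)) : R :=
  \big[Num.max/0]_i \sum_j `|A i j|.

(* Largest real eigenvalue. The spectrum is finite, so this is a maximum as
   soon as a real eigenvalue exists (lambda_maxP), as Perron-Frobenius ensures
   for a nonnegative matrix of positive size; sup set0 = 0 otherwise. *)
Definition lambda_max (R : realType) (k : nat) (A : 'M[R]_k) : R :=
  sup [set a | eigenvalue A a].

Lemma lambda_maxP (R : realType) (k : nat) (A : 'M[R]_k) (a : R) :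
  eigenvalue A a -> eigenvalue A (lambda_max A) /\ a <= lambda_max A.
Proof.
move=> Aa; suff [b Ab lub] : exists2 b, eigenvalue A b &
    forall x, eigenvalue A x -> x <= b.
  suff -> : lambda_max A = b by split=> //; exact: lub.
  apply/le_anti/andP; split; first by apply: ge_sup; [exists a | exact: lub].
  by apply: ub_le_sup => //; exists b; exact: lub.
have [s sP] : exists s : seq R, forall x, root (char_poly A) x -> x \in s.
  have : char_poly A != 0 by apply/monic_neq0/char_poly_monic.
  have [k'] := ubnP (size (char_poly A)).
  elim: k' (char_poly A) => // k' IH p; rewrite ltnS => sp p0.
  have [[x px]|nopx] := pselect (exists x, root p x); last first.
    by exists [::] => x px; case: nopx; exists x.
  have [q pE] := factor_theorem _ _ px.
  have q0 : q != 0 by apply: contraNneq p0 => q0; rewrite pE q0 mul0r.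
  have [|s sP] := IH q _ q0.
    by move: sp; rewrite pE size_Mmonic ?monicXsubC// size_XsubC addn2.
  exists (x :: s) => y; rewrite pE rootM root_XsubC in_cons orbC.
  by case/orP => [->//|/sP ->]; rewrite orbT.
exists (\big[Num.max/a]_(x <- s | eigenvalue A x) x).
  by elim/big_ind: _ => // x y Ax Ay; case: (leP x y).
move=> x Ax; apply: (le_bigmax_seq a x (eigenvalue A) id) => //.
by apply: sP; rewrite -eigenvalue_root_char.
Qed.

(* d, dh, d' : input, hidden and output dimensions. *)
Record ihgnn_weights (R : realType) (d dh d' : nat) := IhgnnWeights {
  iW : 'M[R]_dh;
  iTheta1 : 'M[R]_(d, dh);
  iTheta2 : 'M[R]_(dh, d');
  ib : 'cV[R]_dh
}.

Section IHGNN.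
Context (R : realType) (n m d dh d' : nat).
Context (G : hypergraph R n m) (phi : R -> R) (N : ihgnn_weights R d dh d').

Definition is_equilibrium (X : 'M[R]_(n, d)) (Z : 'M[R]_(n, dh)) : Prop :=
  Z = map_mx phi (laplacian_mx G *m Z *m iW N + X *m iTheta1 N
                  + (const_mx 1 : 'cV[R]_n) *m (ib N)^T).

Definition ihgnn_well_defined : Prop :=
  forall X : 'M[R]_(n, d), exists! Z, is_equilibrium X Z.

(* The default value 0 of xget is irrelevant under ihgnn_well_defined. *)
Definition equilibrium (X : 'M[R]_(n, d)) : 'M[R]_(n, dh) :=
  xget 0 [set Z | is_equilibrium X Z].

Definition ihgnn (X : 'M[R]_(n, d)) : 'M[R]_(n, d') :=
  equilibrium X *m iTheta2 N.

End IHGNN.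

(* Main.v *)
Require Import Defs.
From HB Require Import structures.
From mathcomp Require Import ring.
From mathcomp Require Import functions interval_inference sequences.

(** Perron-Frobenius theory enters only through one consequence: if a
    nonnegative matrix [A] has no real eigenvalue [>= 1], some positive [s]
    satisfies [A s < s]. For [A = |W|], conjugating [W] by the diagonal matrix
    of [s] brings every absolute row sum below 1, and positive homogeneity of
    the activation makes this conjugation commute with it, so that
    equilibria correspond through [Z |-> Z Diag(s)]. Applied to [|W|^T], the
    same consequence makes the equilibrium equation a contraction in a weighted
    sup norm, hence well posed. *)

Set Implicit Arguments.
Unset Strict Implicit.
Unset Printing Implicit Defensive.

(** * Positive strict supersolutions of nonnegative matrices *)

Section NonnegativeMatrices.
Context (R : realType) (k : nat).
Implicit Types (A : 'M[R]_k) (s x : 'cV[R]_k) (t : R).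

(* At an index minimising [x i / s i], a negative minimum c would give
   [t * x = c * t * s < c * (A s) <= A x] in that coordinate. *)
Lemma mulmx_le_ge0 A t s x :
    (forall i j, 0 <= A i j) -> (forall i, 0 < s i 0) ->
    (forall i, (A *m s) i 0 < t * s i 0) ->
    (forall i, (A *m x) i 0 <= t * x i 0) ->
  forall i, 0 <= x i 0.
Proof.
move=> A0 s0 As Ax i.
case: (@arg_minP _ _ _ i xpredT (fun j => x j 0 / s j 0)) => // j _ jmin.
set c := x j 0 / s j 0 in jmin.
have cs l : c * s l 0 <= x l 0 by rewrite -ler_pdivlMr// jmin.
have xj : x j 0 = c * s j 0 by rewrite divfK// gt_eqF.
suff c0 : 0 <= c by rewrite (le_trans _ (cs i))// mulr_ge0// ltW.
rewrite leNgt; apply/negP => c0.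
have : c * (A *m s) j 0 <= (A *m x) j 0.
  rewrite !mxE mulr_sumr; apply: ler_sum => l _.
  by rewrite mulrCA ler_wpM2l.
apply/negP; rewrite -ltNge (le_lt_trans (Ax j))// xj mulrCA.
by rewrite ltr_nM2l.
Qed.

(* Let [t0] be the infimum of the [t >= 1] such that [A s < t s] for some
   positive [s]. By [mulmx_le_ge0] for [t] slightly above [t0], the vector
   [(t0 - A)^-1 1] is nonnegative, so the infimum is attained; as
   [A s < t s] is an open condition on [t], [t0 = 1]. *)
Lemma pos_supersolution A :
    (forall i j, 0 <= A i j) ->
    (forall t, 1 <= t -> t%:M - A \in unitmx) ->
  exists2 s : 'cV[R]_k, (forall i, 0 < s i 0) &
    (forall i, (A *m s) i 0 < s i 0).
Proof.
move=> A0 unitA.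
pose T : set R := [set t | 1 <= t /\ exists2 s : 'cV[R]_k,
  (forall i, 0 < s i 0) & (forall i, (A *m s) i 0 < t * s i 0)].
have T_neq0 : T !=set0.
  (* The sum of all entries bounds each row sum, so the all-ones vector is a witness. *)
  exists (1 + \sum_i \sum_j A i j); split.
    by rewrite lerDl; do 2!apply: sumr_ge0 => ? _.
  exists (const_mx 1) => i; first by rewrite mxE.
  rewrite [ltLHS]mxE [X in _ * X]mxE mulr1.
  rewrite (eq_bigr (A i)); last by move=> j _; rewrite mxE mulr1.
  rewrite [in ltRHS](bigD1 i)//= addrCA ltrDl ltr_pwDl//.
  by do 2!apply: sumr_ge0 => ? _.
have T_inf : has_inf T by split=> //; exists 1 => t [].
set t0 := inf T.
have t0_ge1 : 1 <= t0 by apply: lb_le_inf => // t [].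
have [_ [s s0 As]] : T t0.
  split=> //; pose s : 'cV[R]_k := invmx (t0%:M - A) *m const_mx 1.
  have Es i : t0 * s i 0 = 1 + (A *m s) i 0.
    have /matrixP/(_ i 0) : (t0%:M - A) *m s = const_mx 1.
      by rewrite mulmxA mulmxV ?unitA// mul1mx.
    by rewrite mulmxBl mul_scalar_mx !mxE => /eqP; rewrite subr_eq => /eqP.
  (* For [t] within [e] of [t0], each [(t - t0) * s i 0] is at most 1 in absolute value, so that
     [t s = A s + 1 + (t - t0) s >= A s]. *)
  pose e := (1 + \sum_i `|s i 0|)^-1.
  have S0 : 0 <= \sum_i `|s i 0| by exact: sumr_ge0.
  have e0 : 0 < e by rewrite invr_gt0 ltr_pwDl.
  have [t [t1 [s' s'0 As']] tlt] := inf_adherent e0 T_inf.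
  have t0t : t0 <= t by apply: ge_inf; [case: T_inf|split=> //; exists s'].
  have s_ge0 i : 0 <= s i 0.
    apply: (mulmx_le_ge0 A0 s'0 As') => {}i.
    have -> : t * s i 0 = (A *m s) i 0 + (1 + (t - t0) * s i 0).
      by rewrite mulrBl Es; ring.
    rewrite lerDl.
    have : `|(t - t0) * s i 0| <= 1.
      rewrite normrM ger0_norm ?subr_ge0//.
      apply: (@le_trans _ _ (e * (1 + \sum_i `|s i 0|))).
        apply: ler_pM => //; first by rewrite subr_ge0.
          by rewrite lerBlDl ltW.
        rewrite (bigD1 i)//= addrCA lerDl addr_ge0//; exact: sumr_ge0.
      by rewrite mulVf// gt_eqF// ltr_pwDl.
    by rewrite ler_norml => /andP[+ _]; rewrite lerNl -subr_ge0 opprK.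
  have As_ge0 i : 0 <= (A *m s) i 0.
    by rewrite mxE sumr_ge0// => j _; rewrite mulr_ge0.
  exists s => i; last by rewrite Es ltrDr.
  rewrite -(pmulr_rgt0 _ (lt_le_trans ltr01 t0_ge1)) Es.
  by rewrite ltr_pwDl.
suff t0_eq1 : t0 = 1 by exists s => // i; rewrite -[ltRHS]mul1r -t0_eq1.
apply/eqP; rewrite eq_le t0_ge1 andbT leNgt; apply/negP => t0_gt1.
(* [t1] is the least [t >= 1] with [A s <= t s], and [t1 < t0]; their midpoint then lies in [T],
   below its infimum. *)
pose t1 := \big[Num.max/1]_i ((A *m s) i 0 / s i 0).
have t1_ge1 : 1 <= t1 by exact: bigmax_ge_id.
have t1_lt : t1 < t0 by apply: bigmax_lt => // i _; rewrite ltr_pdivrMr.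
have : t0 <= (t1 + t0) / 2.
  apply: ge_inf; first by case: T_inf.
  split; first by rewrite (le_trans t1_ge1)// midf_le// ltW.
  exists s => // i; apply: (@le_lt_trans _ _ (t1 * s i 0)).
    by rewrite -ler_pdivrMr// (le_bigmax _ (fun i => (A *m s) i 0 / s i 0)).
  by rewrite ltr_pM2r// midf_lt.
by rewrite leNgt midf_lt.
Qed.

End NonnegativeMatrices.

Lemma unitmx_no_eigenvalue (F : fieldType) k (A : 'M[F]_k) (t : F) :
  ~~ eigenvalue A t -> t%:M - A \in unitmx.
Proof.
apply: contraNT; rewrite unitmxE unitfE negbK => /det0P[v v0 vA].
apply/eigenvalueP; exists v => //; apply/eqP.
by rewrite eq_sym -subr_eq0 -mul_mx_scalar -mulmxBr vA.
Qed.

(** * Fixed points of contractions in a weighted sup norm *)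

Lemma lipschitz_lt1_fixpoint (R : realType) (X : completeNormedModType R)
    (f : X -> X) (q : R) :
    0 <= q < 1 -> (forall x y, `|f x - f y| <= q * `|x - y|) ->
  exists! x, x = f x.
Proof.
move=> /andP[q0 q1] fq.
pose fm := isFun.Build X X setT setT f (fun _ _ => I).
pose g : {fun setT >-> setT} := HB.pack f fm.
have gP : is_contraction g.
  by exists (NngNum q0); split=> // -[x y] _; exact: fq.
have [|p _ pE] := banach_fixed_point gP closedT; first by exists 0.
exists p; split=> // p' p'E.
exact: (contraction_fixpoint_unique gP).
Qed.

(** Makes matrices under the largest-entry norm a [completeNormedModType], so that
    [lipschitz_lt1_fixpoint] applies to them. *)
HB.instance Definition _ (R : realType) (n k : nat) :=
  Complete.on 'M[R]_(n, k).

Lemma mx_norm_le (R : realType) n k (Z : 'M[R]_(n, k)) (c : R) :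
  0 <= c -> (`|Z| <= c) <-> (forall i j, `|Z i j| <= c).
Proof.
move=> c0; rewrite [`|Z|]mx_normrE; split=> [/bigmax_leP[_ Zc] i j|Zc].
  exact: (Zc (i, j)).
by apply: bigmax_le => // -[].
Qed.

(* Banach's theorem for the sup norm weighted by [u i * y j]. *)
Lemma weighted_contraction_fixpoint (R : realType) n k
    (F : 'M[R]_(n, k) -> 'M[R]_(n, k)) (u : 'I_n -> R) (y : 'I_k -> R) (q : R) :
    0 <= q < 1 -> (forall i, 0 < u i) -> (forall j, 0 < y j) ->
    (forall (Z Z' : 'M[R]_(n, k)) (c : R),
      (forall i j, `|Z i j - Z' i j| <= c * (u i * y j)) ->
      forall i j, `|F Z i j - F Z' i j| <= q * c * (u i * y j)) ->
  exists! Z, Z = F Z.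
Proof.
move=> q01 u0 y0 FP; have [q0 _] := andP q01.
have w0 i j : 0 < u i * y j by rewrite mulr_gt0.
have wN0 i j : u i * y j != 0 by rewrite gt_eqF.
(* Conjugating [F] by the entrywise weights turns the weighted norm into the plain one. *)
pose up (V : 'M[R]_(n, k)) := \matrix_(i, j) (V i j * (u i * y j)).
pose down (V : 'M[R]_(n, k)) := \matrix_(i, j) (V i j / (u i * y j)).
have downK : cancel down up.
  by move=> V; apply/matrixP => i j; rewrite !mxE divfK.
have [|V [VE Vuniq]] := @lipschitz_lt1_fixpoint R 'M[R]_(n, k)
    (down \o F \o up) q q01.
  move=> V V'; apply/mx_norm_le; first by rewrite mulr_ge0.
  move=> i j; rewrite !mxE /= -mulrBl normrM [X in _ * X]gtr0_norm ?invr_gt0//.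
  rewrite ler_pdivrMr//; apply: FP => {}i {}j.
  rewrite !mxE -mulrBl normrM [X in _ * X]gtr0_norm//.
  rewrite ler_wpM2r ?(ltW (w0 _ _))//.
  by have /mx_norm_le/(_ i j) := lexx `|V - V'|; rewrite !mxE; exact.
exists (up V); split; first by rewrite {1}VE /= downK.
by move=> Z ZE; rewrite (Vuniq (down Z)) ?downK// /= downK -ZE.
Qed.

(** * Nonnegativity and a positive fixed vector of the Laplacian *)

Section Laplacian.
Context (R : realType) (n m : nat) (G : hypergraph R n m).

Lemma hedge_degree_gt0 j : 0 < hedge_degree G j.
Proof.
have /set0Pn[i ij] := hedge_neq0 G j.
rewrite /hedge_degree (bigD1 i)//= mxE ij ltr_pwDl// sumr_ge0// => l _.
by rewrite mxE.
Qed.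

Lemma invmx_hedge_degree_mx :
  invmx (hedge_degree_mx G) = diag_mx (\row_j (hedge_degree G j)^-1).
Proof.
have BV : diag_mx (\row_j (hedge_degree G j)^-1) *m hedge_degree_mx G = 1%:M.
  rewrite mulmx_diag -[RHS]diag_const_mx; congr diag_mx.
  by apply/rowP => j; rewrite !mxE mulVf// gt_eqF// hedge_degree_gt0.
have [_ unitB] := mulmx1_unit BV.
by rewrite -[LHS]mul1mx -BV mulmxK.
Qed.

Lemma laplacian_mxE i k : laplacian_mx G i k =
  (Num.sqrt (node_degree G i))^-1 *
  (\sum_j incidence_mx G i j * hweight G 0 j * (hedge_degree G j)^-1
     * incidence_mx G k j) * (Num.sqrt (node_degree G k))^-1.
Proof.
have DE l : node_degree_mx G l l = node_degree G l by rewrite !mxE eqxx.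
rewrite /laplacian_mx invmx_hedge_degree_mx mul_mx_diag mxE [X in _ * X]mxE DE.
congr (_ * _); rewrite mxE mulr_sumr; apply: eq_bigr => j _.
by rewrite mul_mx_diag mxE mul_mx_diag mxE mul_diag_mx !mxE eqxx !mulrA.
Qed.

Hypothesis adm : admissible G.

Lemma node_degree_gt0 i : 0 < node_degree G i.
Proof. by have [_ /(_ i)] := adm; rewrite !mxE eqxx. Qed.

Lemma laplacian_mx_ge0 i k : 0 <= laplacian_mx G i k.
Proof.
rewrite laplacian_mxE !mulr_ge0 ?invr_ge0 ?sqrtr_ge0// sumr_ge0// => j _.
have [w0 _] := adm.
by rewrite !mulr_ge0 ?invr_ge0 ?(ltW (hedge_degree_gt0 j))// mxE.
Qed.

(** The right factor [D^(-1/2)] sends the square roots to the all-ones vector, [B^(-1)] cancels the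
    column sums of [H], and the weighted row sums of [H] that remain are the degrees. *)
Lemma laplacian_mx_sqrt_degree i :
  \sum_k laplacian_mx G i k * Num.sqrt (node_degree G k) =
  Num.sqrt (node_degree G i).
Proof.
have s0 k : Num.sqrt (node_degree G k) != 0.
  by rewrite gt_eqF// sqrtr_gt0 node_degree_gt0.
under eq_bigr do rewrite laplacian_mxE divfK//.
rewrite -mulr_sumr exchange_big/=.
rewrite (eq_bigr (fun j => incidence_mx G i j * hweight G 0 j)).
  apply: (mulfI (s0 i)); rewrite mulVKf//.
  by rewrite -expr2 sqr_sqrtr// ltW// node_degree_gt0.
move=> j _; rewrite -mulr_sumr -/(hedge_degree G j) divfK//.
by rewrite gt_eqF// hedge_degree_gt0.
Qed.

End Laplacian.

(** * Consequences of the spectral condition *)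

Lemma pos_right_supersolution (R : realType) k (W : 'M[R]_k) :
    lambda_max (abs_mx W) < 1 ->
  exists2 s : 'I_k -> R, (forall i, 0 < s i) &
    (forall i, \sum_j `|W i j| * s j < s i).
Proof.
move=> W1.
have [|t t1|s s0 sW] := @pos_supersolution R k (abs_mx W).
- by move=> i j; rewrite mxE.
(* An eigenvalue [t >= 1] would exceed [lambda_max]. *)
- apply: unitmx_no_eigenvalue; apply: contraL t1 => /lambda_maxP[_ tW].
  by rewrite -ltNge (le_lt_trans tW).
exists (fun i => s i 0) => // i; have := sW i.
by rewrite mxE; under eq_bigr do rewrite mxE.
Qed.

Lemma char_poly_tr (K : comNzRingType) k (A : 'M[K]_k) :
  char_poly A^T = char_poly A.
Proof.
rewrite /char_poly -[RHS]det_tr; congr (\det _).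
by rewrite /char_poly_mx raddfB/= tr_scalar_mx map_trmx.
Qed.

Lemma lambda_max_tr (R : realType) k (A : 'M[R]_k) :
  lambda_max A^T = lambda_max A.
Proof.
by congr sup; apply/seteqP; split=> t /=;
  rewrite !eigenvalue_root_char char_poly_tr.
Qed.

Lemma pos_left_supersolution (R : realType) k (W : 'M[R]_k) :
    lambda_max (abs_mx W) < 1 ->
  exists2 s : 'I_k -> R, (forall j, 0 < s j) &
    (forall j, \sum_i s i * `|W i j| < s j).
Proof.
rewrite -lambda_max_tr /abs_mx map_trmx => /pos_right_supersolution[s s0 sW].
exists s => // j; have := sW j.
by under eq_bigr do rewrite mxE mulrC.
Qed.

(* [phi] being nonexpansive, the update [Z |-> phi (M Z W + C)] moves two
   points apart by at most [M |Z - Z'| |W|]. With [M u = u] for the square roots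
   [u] of the degrees and [s |W| < s], this contracts the sup norm weighted by
   [u i * s j]. *)
Lemma lambda_max_lt1_well_defined (R : realType) (n m d dh d' : nat)
    (G : hypergraph R n m) (phi : R -> R) (N : ihgnn_weights R d dh d') :
    nonexpansive phi -> admissible G -> lambda_max (abs_mx (iW N)) < 1 ->
  ihgnn_well_defined G phi N.
Proof.
move=> phi1 admG W1 X.
have {}phi1 a b : `|phi a - phi b| <= `|a - b|.
  by have /= := phi1 (a, b) (conj I I); rewrite mul1r.
have [s s0 sW] := pos_left_supersolution W1.
(* The least nonnegative [q] with [s |W| <= q s]. *)
pose q := \big[Num.max/0]_j ((\sum_l s l * `|iW N l j|) / s j).
have q01 : 0 <= q < 1.
  rewrite bigmax_ge_id bigmax_lt// => j _.
  by rewrite ltr_pdivrMr// mul1r.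
have sWq j : \sum_l s l * `|iW N l j| <= q * s j.
  rewrite -ler_pdivrMr//.
  exact: (le_bigmax _ (fun j => (\sum_l s l * `|iW N l j|) / s j)).
pose u i := Num.sqrt (node_degree G i).
have u0 i : 0 < u i by rewrite sqrtr_gt0 node_degree_gt0.
apply: (weighted_contraction_fixpoint q01 u0 s0) => Z Z' c ZZ' i j.
rewrite [X in `|X - _|]mxE [X in `|_ - X|]mxE; apply: (le_trans (phi1 _ _)).
set Y := X *m _; set C := const_mx 1 *m _.
have -> : (laplacian_mx G *m Z *m iW N + Y + C) i j
    - (laplacian_mx G *m Z' *m iW N + Y + C) i j
    = \sum_l \sum_k laplacian_mx G i k * (Z k l - Z' k l) * iW N l j.
  rewrite [X in X - _]mxE [X in X + _ - _]mxE.
  rewrite [X in _ - X]mxE [X in _ - (X + _)]mxE.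
  rewrite opprD addrACA subrr addr0 opprD addrACA subrr addr0.
  rewrite !mxE -sumrB; apply: eq_bigr => l _.
  rewrite -mulrBl !mxE -sumrB mulr_suml; apply: eq_bigr => k _.
  by rewrite -mulrBr.
have c0 : 0 <= c.
  by rewrite -(pmulr_lge0 _ (mulr_gt0 (u0 i) (s0 j))) (le_trans _ (ZZ' i j)).
apply: (@le_trans _ _ (\sum_l \sum_k
    laplacian_mx G i k * (c * (u k * s l)) * `|iW N l j|)).
  apply: le_trans (ler_norm_sum _ _ _) _; apply: ler_sum => l _.
  apply: le_trans (ler_norm_sum _ _ _) _; apply: ler_sum => k _.
  rewrite !normrM ler_wpM2r// ger0_norm ?laplacian_mx_ge0//.
  by rewrite ler_wpM2l// laplacian_mx_ge0.
(* The double sum factors: the one over [k] collapses by [M u = u], the one over [l] is bounded by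
   [q * s j]. *)
rewrite [leLHS](_ : _ = c * u i * \sum_l s l * `|iW N l j|).
  rewrite (_ : q * c * _ = c * u i * (q * s j)); last by ring.
  by rewrite ler_wpM2l// mulr_ge0// ltW.
rewrite -[u i](laplacian_mx_sqrt_degree admG) -mulrA mulr_suml mulr_sumr.
rewrite exchange_big /=; apply: eq_bigr => k _.
by rewrite !mulr_sumr; apply: eq_bigr => l _; rewrite -/(u k); ring.
Qed.

Lemma equilibriumE (R : realType) (n m d dh d' : nat)
    (G : hypergraph R n m) (phi : R -> R) (N : ihgnn_weights R d dh d') X Z :
    ihgnn_well_defined G phi N -> is_equilibrium G phi N X Z ->
  equilibrium G phi N X = Z.
Proof.
move=> /(_ X)[Z0 [Z0P Z0u]] ZP; rewrite -(Z0u _ ZP).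
by rewrite /equilibrium; case: xgetP => [Z1 _ /Z0u<-|/(_ Z0)/(_ Z0P)].
Qed.

(** * Diagonal rescaling of the hidden layer *)

Section Rescaling.
Context (R : realType) (d dh d' : nat) (N : ihgnn_weights R d dh d').
Variable s : 'rV[R]_dh.
Hypothesis s0 : forall i, 0 < s 0 i.

Let r : 'rV[R]_dh := \row_i (s 0 i)^-1.

(** The change of variable [Z |-> Z Diag(s)] in the equilibrium equation; the output weights absorb
    the inverse scaling. *)
Definition rescale : ihgnn_weights R d dh d' :=
  IhgnnWeights (diag_mx r *m iW N *m diag_mx s) (iTheta1 N *m diag_mx s)
    (diag_mx r *m iTheta2 N) (diag_mx s *m ib N).

Let sr : diag_mx s *m diag_mx r = 1%:M.
Proof.
rewrite mulmx_diag -[RHS]diag_const_mx; congr diag_mx.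
by apply/rowP => j; rewrite !mxE mulfV// gt_eqF.
Qed.

Let rs : diag_mx r *m diag_mx s = 1%:M.
Proof. exact: mulmx1C. Qed.

Context (n m : nat) (G : hypergraph R n m) (phi : R -> R).
Hypothesis phi_hom : pos_homogeneous phi.

Let map_phi_diag (A : 'M[R]_(n, dh)) :
  map_mx phi (A *m diag_mx s) = map_mx phi A *m diag_mx s.
Proof.
apply/matrixP => i j; rewrite !mul_mx_diag !mxE mulrC phi_hom 1?mulrC//.
exact: ltW.
Qed.

(** [Diag(s) Diag(s)^(-1)] cancels in front of [W], so [Diag(s)] factors out of the whole
    pre-activation on the right and passes through [phi]. *)
Lemma rescale_equilibrium X Z :
  is_equilibrium G phi N X Z <->
  is_equilibrium G phi rescale X (Z *m diag_mx s).
Proof.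
rewrite /is_equilibrium /=.
have -> : laplacian_mx G *m (Z *m diag_mx s) *m
      (diag_mx r *m iW N *m diag_mx s) + X *m (iTheta1 N *m diag_mx s) +
      const_mx 1 *m (diag_mx s *m ib N)^T =
    (laplacian_mx G *m Z *m iW N + X *m iTheta1 N + const_mx 1 *m (ib N)^T)
      *m diag_mx s.
  rewrite trmx_mul tr_diag_mx !mulmxA -(mulmxA _ (diag_mx s) (diag_mx r)) sr.
  by rewrite mulmx1 !mulmxDl.
rewrite map_phi_diag; split=> [<-//|/(congr1 (mulmx^~ (diag_mx r)))].
by rewrite -!mulmxA sr !mulmx1.
Qed.

Lemma rescale_well_defined :
  ihgnn_well_defined G phi N -> ihgnn_well_defined G phi rescale.
Proof.
move=> wdN X; have [Z [ZP Zu]] := wdN X.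
exists (Z *m diag_mx s); split; first exact/rescale_equilibrium.
(* Every candidate is a rescaled matrix, so uniqueness transfers. *)
move=> Y YP; have YE : Y = Y *m diag_mx r *m diag_mx s.
  by rewrite -mulmxA rs mulmx1.
rewrite YE; congr (_ *m _); apply: Zu.
by apply/rescale_equilibrium; rewrite -YE.
Qed.

Lemma ihgnn_rescale X :
  ihgnn_well_defined G phi N -> ihgnn G phi rescale X = ihgnn G phi N X.
Proof.
move=> wdN; have [Z [ZP _]] := wdN X; rewrite /ihgnn (equilibriumE wdN ZP).
have ZsP := (rescale_equilibrium X Z).1 ZP.
rewrite (equilibriumE (rescale_well_defined wdN) ZsP)/=.
by rewrite mulmxA -(mulmxA Z) sr mulmx1.
Qed.

Lemma norm_inf_rescale_lt1 :
  (forall i, \sum_j `|iW N i j| * s 0 j < s 0 i) -> norm_inf (iW rescale) < 1.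
Proof.
move=> sW; apply: bigmax_lt => // i _ /=.
rewrite (eq_bigr (fun j => (s 0 i)^-1 * (`|iW N i j| * s 0 j))).
  by rewrite -mulr_sumr mulrC ltr_pdivrMr// mul1r.
move=> j _; rewrite mul_mx_diag mxE mul_diag_mx !mxE !normrM mulrA.
by rewrite [`|_^-1|]gtr0_norm ?invr_gt0// [`|s 0 j|]gtr0_norm.
Qed.

End Rescaling.

Theorem theorem4p12 (R : realType) (n m d dh d' : nat)
    (G : hypergraph R n m) (phi : R -> R) (N : ihgnn_weights R d dh d')
    (hphi_hom : pos_homogeneous phi) (hphi_nonexp : nonexpansive phi)
    (hG : admissible G) (hW : lambda_max (abs_mx (iW N)) < 1) :
  exists N' : ihgnn_weights R d dh d',
    [/\ norm_inf (iW N') < 1,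
        ihgnn_well_defined G phi N,
        ihgnn_well_defined G phi N' &
        forall X : 'M[R]_(n, d), ihgnn G phi N X = ihgnn G phi N' X].
Proof.
have wdN := lambda_max_lt1_well_defined hphi_nonexp hG hW.
have [s s0 sW] := pos_right_supersolution hW.
pose v := \row_i s i; have v0 i : 0 < v 0 i by rewrite mxE.
exists (rescale N v); split=> //.
- apply: norm_inf_rescale_lt1 => // i.
  by rewrite mxE; under eq_bigr do rewrite mxE.
- exact: rescale_well_defined.
- by move=> X; rewrite ihgnn_rescale.
Qed.
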